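(* Let $F\in W^{1,2}$ have Blaschke decomposition $F=B\cdot G$. Suppose $F$ has a finite number of roots in $\mathbb{D}$, labeled $\alpha_1,\alpha_2,\dots,\alpha_m$ (listed with multiplicity). Then $$\|G\|_{W^{1,2}}^2\le\|F\|_{W^{1,2}}^2-\sum_{j=1}^m(1-|\alpha_j|^2)\left[2\left\|\frac{G(e^{i\cdot})}{1-\overline{\alpha_j}e^{i\cdot}}\right\|_{\mathcal{D}}^2-\left\|\frac{G(e^{i\cdot})}{1-\overline{\alpha_j}e^{i\cdot}}\right\|_{\mathcal{H}^2}^2\right].$$
   Context: $\mathbb{D}$ is the open unit disc. For an analytic function $F(z)=\sum_{n\ge0}a_nz^n$ on $\mathbb{D}$ put $$\|F\|_{\mathcal{H}^2}^2=\sum_{n\ge0}|a_n|^2,\qquad \|F\|_{\mathcal{D}}^2=\sum_{n\ge0}(n+1)|a_n|^2,\qquad \|F\|_{W^{1,2}}^2=\sum_{n\ge0}(n^2+1)|a_n|^2.$$ The Hardy space $\mathcal{H}^2$, Dirichlet space $\mathcal{D}$ and Hardy-Sobolev space $W^{1,2}$ are the spaces of analytic functions on $\mathbb{D}$ for which the corresponding quantity is finite. A function $h(e^{i\cdot})$ on the circle is identified with the analytic function $h(z)$ on $\mathbb{D}$ of which it is the boundary function; norms are computed from the Taylor coefficients of $h$. Blaschke decomposition: if $F\in\mathcal{H}^2$ has zeros $\alpha_1,\dots,\alpha_m$ in $\mathbb{D}$ (repeated according to multiplicity), then $F=B\cdot G$ with $B(z)=\prod_{j=1}^m\frac{z-\alpha_j}{1-\overline{\alpha_j}z}$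 and $G\in\mathcal{H}^2$ without zeros in $\mathbb{D}$ ($B$ and $G$ are determined up to a unimodular constant, which does not affect the norms). *)

(* Defs.v *)
From mathcomp Require Import all_boot all_order all_algebra.
From mathcomp Require Import all_classical all_reals all_analysis.
From mathcomp Require Import complex.

Set Implicit Arguments.
Unset Strict Implicit.
Unset Printing Implicit Defensive.

Import Order.TTheory GRing.Theory Num.Theory.
Import numFieldNormedType.Exports.

Local Open Scope classical_set_scope.
Local Open Scope ring_scope.
Local Open Scope complex_scope.

Section DiscFunctions.
Variable R : realType.
Implicit Types (F G f : R[i] -> R[i]) (z : R[i]).

Definition unit_disc : set R[i] := [set z | `|z| < 1].

(* Functions on the disc are total functions on R[i] whose values outside the
   disc are never used. The topology on the scalars is found on the alias
   R[i]^o. *)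
Definition has_taylor f (a : nat -> R[i]) : Prop :=
  forall z, unit_disc z ->
    [series (a k * z ^+ k : R[i]^o)]_k @ \oo --> (f z : R[i]^o).

Definition analytic f : Prop := exists a, has_taylor f a.

(* By uniqueness of power series expansions the choice is no choice at all when
   f is analytic; the value is the junk sequence 0 otherwise. *)
Definition taylor f : nat -> R[i] := xget (fun=> 0) (has_taylor f).

Definition weighted_normsq (w : nat -> R) f : \bar R :=
  (\sum_(0 <= n <oo) (w n * Normc.normc (taylor f n) ^+ 2)%:E)%E.

Definition H2_normsq : (R[i] -> R[i]) -> \bar R :=
  weighted_normsq (fun=> 1).

Definition Dirichlet_normsq : (R[i] -> R[i]) -> \bar R :=
  weighted_normsq (fun n => n%:R + 1).

Definition W12_normsq : (R[i] -> R[i]) -> \bar R :=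
  weighted_normsq (fun n => n%:R ^+ 2 + 1).

Definition in_H2 f : Prop := analytic f /\ (H2_normsq f < +oo)%E.

Definition in_W12 f : Prop := analytic f /\ (W12_normsq f < +oo)%E.

(* A nonvanishing point has order 0; the zero function has no order. *)
Definition vanishing_order f (a : R[i]) (k : nat) : Prop :=
  exists h, [/\ analytic h, h a != 0 &
    forall z, unit_disc z -> f z = (z - a) ^+ k * h z].

(* alpha_0, ..., alpha_(m-1) are the zeros of f in the disc, each listed as many
   times as its multiplicity. *)
Definition disc_zeros f (m : nat) (alpha : 'I_m -> R[i]) : Prop :=
  (forall j, unit_disc (alpha j)) /\
  (forall a, unit_disc a -> vanishing_order f a #|[set j | alpha j == a]|).

Definition blaschke (m : nat) (alpha : 'I_m -> R[i]) z : R[i] :=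
  \prod_(j < m) ((z - alpha j) / (1 - (alpha j)^* * z)).

Definition blaschke_decomposition F (m : nat) (alpha : 'I_m -> R[i]) G : Prop :=
  [/\ in_H2 G,
      forall z, unit_disc z -> G z != 0 &
      forall z, unit_disc z -> F z = blaschke alpha z * G z].

End DiscFunctions.

(* Main.v *)
(** For one zero [a] put [H = G / (1 - conj a * z)], with Taylor coefficients [h_n], [h_(-1) = 0].
   Then [G] and [(z - a) / (1 - conj a * z) * G = (z - a) * H] have coefficients
   [h_n - conj a * h_(n-1)] and [h_(n-1) - a * h_n], whose squared moduli differ by
   [(1 - |a|^2) (|h_(n-1)|^2 - |h_n|^2)]. Summation by parts against a nondecreasing weight [w]
   shows that multiplying [G] by the Blaschke factor raises the [w]-norm by at least
   [(1 - |a|^2)] times the norm of [H] with the increments [w_(n+1) - w_n] as weights. For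
   [w_n = n^2 + 1] the increments are [2n + 1 = 2(n + 1) - 1], that is, twice the Dirichlet norm
   minus the Hardy norm, and they increase as well, so replacing [G] by its product with some of
   the other factors only enlarges each gain. Summing the gains over the zeros gives the bound. *)

Require Import Defs.
From mathcomp Require Import all_boot all_order all_algebra.
From mathcomp Require Import all_classical all_reals all_analysis.
From mathcomp Require Import complex zify ring lra.

Set Implicit Arguments.
Unset Strict Implicit.
Unset Printing Implicit Defensive.

Import Order.TTheory GRing.Theory Num.Theory.
Import numFieldNormedType.Exports.

Local Open Scope ring_scope.
Local Open Scope complex_scope.

Import Normc.

(** * The real-valued modulus and convergence in [R[i]] *)

Lemma normc_ge0 (R : rcfType) (x : R[i]) : 0 <= normc x.
Proof. by case: x => a b; exact: sqrtr_ge0. Qed.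

Lemma normcX (R : rcfType) (x : R[i]) n : normc (x ^+ n) = normc x ^+ n.
Proof. by elim: n => [|n IH]; rewrite ?expr0 ?normc1// !exprS normcM IH. Qed.

Lemma normc_real (R : rcfType) (t : R) : 0 <= t -> normc t%:C = t.
Proof. by move=> t0; rewrite /normc /= expr0n addr0 sqrtr_sqr ger0_norm. Qed.

Lemma le_normc_sum (R : rcfType) (x : nat -> R[i]) (n : nat) :
  normc (\sum_(0 <= k < n) x k) <= \sum_(0 <= k < n) normc (x k).
Proof.
elim: n => [|n IH]; first by rewrite !big_geq// normc0.
by rewrite !big_nat_recr//= (le_trans (le_normcD _ _))// lerD2r.
Qed.

Lemma unit_discE (R : realType) (z : R[i]) : unit_disc z <-> normc z < 1.
Proof. by rewrite -ltcR. Qed.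

(** Turns complex limits into limits of real moduli, where squeezing and real arithmetic apply. *)
Lemma cvg_normcP (R : realType) (u : nat -> R[i]) (l : R[i]) :
  (u @ \oo --> (l : R[i]^o))%classic <->
  ((fun n => normc (u n - l)) @ \oo --> (0 : R))%classic.
Proof.
split=> [/(@cvgrPdist_lt _ R[i]^o) ul|/cvgrPdist_lt ul].
  apply/cvgrPdist_lt => e e0.
  have := ul e%:C; rewrite (ltcR 0 e) => /(_ e0).
  apply: filterS => n.
  rewrite distrC sub0r normrN (ger0_norm (normc_ge0 (u n - l))).
  by rewrite -ltcR.
(* A positive element of [R[i]] is real, so only real tolerances have to be met. *)
apply/(@cvgrPdist_lt _ R[i]^o) => -[a b]; rewrite ltcE /= => /andP[/eqP -> a0].
have := ul _ a0; apply: filterS => n.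
rewrite sub0r normrN (ger0_norm (normc_ge0 (u n - l))) distrC => h.
by rewrite -ltcR in h.
Qed.

Lemma squeeze0_cvg (R : realType) (f g : nat -> R) :
  (forall n, 0 <= f n <= g n) ->
  (g @ \oo --> (0 : R))%classic -> (f @ \oo --> (0 : R))%classic.
Proof.
move=> fg g0; apply: (@squeeze_cvgr _ _ _ _ (fun=> 0) g f) => //.
  exact: nearW.
exact: cvg_cst.
Qed.

(** * Uniqueness of Taylor coefficients *)

(** If [d m] is the first nonzero coefficient, then at a small radius its term dominates all later
    ones, so the partial sums stay away from 0. *)
Lemma power_series_eq0 (R : realType) (d : nat -> R[i]) :
  (forall z, normc z < 1 ->
    ((fun n => normc (\sum_(0 <= k < n) d k * z ^+ k)) @ \oo --> (0 : R))%classic) ->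
  forall n, d n = 0.
Proof.
move=> d0 m; elim/ltn_ind: m => m IH; apply: contrapT => /eqP dm0.
have em0 : 0 < normc (d m).
  by rewrite lt_neqAle normc_ge0 andbT eq_sym; apply: contra dm0 => /eqP/eq0_normc->.
(* Partial sums at [z = 1/2] converge, hence are bounded by some [M]. Their differences bound each
   term by [2 * M], which gives growth at most like [2 ^+ k]. *)
have [C C0 dC] : exists2 C, 0 < C & forall k, normc (d (k + m)%N) <= C * 2 ^+ k.
  have h1 : normc (2^-1)%:C = 2^-1 :> R by rewrite normc_real// invr_ge0.
  have := d0 (2^-1)%:C; rewrite h1 => /(_ ltac:(lra)) cv.
  have /cvgP/cvg_seq_bounded/ex_strict_bound_gt0[M M0 MP] := cv.
  have {}MP n : normc (\sum_(0 <= k < n) d k * (2^-1)%:C ^+ k) <= M.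
    by apply: le_trans (ltW (MP n I)); rewrite ler_norm.
  exists ((2 * M + 1) * 2 ^+ m); first by rewrite mulr_gt0 ?exprn_gt0//; lra.
  move=> k; rewrite -mulrA -exprD addnC; set n := (m + k)%N.
  have : normc (d n * (2^-1)%:C ^+ n) <= 2 * M.
    have -> : d n * (2^-1)%:C ^+ n =
        \sum_(0 <= k < n.+1) d k * (2^-1)%:C ^+ k - \sum_(0 <= k < n) d k * (2^-1)%:C ^+ k.
      by rewrite big_nat_recr//= [X in X - _]addrC addrK.
    apply: le_trans (le_normcD _ _) _; rewrite normcN.
    by have := MP n; have := MP n.+1; lra.
  rewrite normcM normcX h1 exprVn -ler_pdivlMr ?invr_gt0 ?exprn_gt0// invrK => h.
  by apply: le_trans h _; rewrite ler_pM2r ?exprn_gt0//; lra.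
(* At this radius the terms of index above [m] add up to at most half of the term of index [m]. *)
pose t : R := normc (d m) / (4 * normc (d m) + 8 * C).
have den0 : 0 < 4 * normc (d m) + 8 * C by lra.
have t0 : 0 < t by rewrite divr_gt0.
have t4 : 4 * t <= 1.
  by rewrite /t mulrA ler_pdivrMr//; lra.
have tC : 8 * C * t <= normc (d m).
  rewrite /t mulrA ler_pdivrMr// mulrC ler_wpM2l//; lra.
clearbody t.
have ht : normc t%:C = t by rewrite normc_real// ltW.
have := d0 t%:C; rewrite ht => /(_ ltac:(lra)) /cvgrPdist_lt.
(* The tail takes away at most half of [normc (d m) * t ^+ m], so a partial sum below a quarter of
   it is contradictory. *)
move=> /(_ (normc (d m) / 4 * t ^+ m)).
move=> /(_ ltac:(by rewrite mulr_gt0 ?exprn_gt0//; lra)) [N0 _ /(_ (N0 + m).+1)] /=.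
move=> /(_ ltac:(by rewrite /=; lia)).
rewrite sub0r normrN ger0_norm ?normc_ge0//.
rewrite (big_cat_nat (n := m)) //=; last by lia.
rewrite big_nat_cond big1 ?add0r; last by move=> k /andP[/andP[_ km] _]; rewrite IH// mul0r.
rewrite -[X in \sum_(X <= _ < _) _]add0n big_addn.
have -> : ((N0 + m).+1 - m = N0.+1)%N by lia.
rewrite big_nat_recl//= add0n => hN.
set D := normc (d m) in em0 den0 tC *.
set T0 := d m * _ in hN; set T1 := \sum_(_ <= _ < _) _ in hN.
have nT0 : normc T0 = D * t ^+ m by rewrite /T0 normcM normcX ht.
(* The extra term [4 * t * (2 * t) ^+ n] makes the bound inductive; the induction step amounts to
   [4 * t <= 1]. *)
have geom n : \sum_(0 <= k < n) (2 * t) ^+ k.+1 + 4 * t * (2 * t) ^+ n <= 4 * t.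
  elim: n => [|n]; first by rewrite big_geq// add0r expr0 mulr1.
  rewrite big_nat_recr//= !exprS.
  set x := (2 * t) ^+ n; set S := \sum_(_ <= _ < _) _.
  have x0 : 0 <= x by rewrite exprn_ge0//; lra.
  have : 0 <= t * x * (1 - 4 * t) by apply: mulr_ge0; [exact: mulr_ge0 (ltW t0) x0|lra].
  by lra.
have nT1 : normc T1 <= C * (4 * t) * t ^+ m.
  apply: le_trans (le_normc_sum _ _) _.
  apply: (@le_trans _ _ (C * (\sum_(0 <= k < N0) (2 * t) ^+ k.+1) * t ^+ m)).
    rewrite mulr_sumr mulr_suml; apply: ler_sum => k _.
    rewrite normcM normcX ht exprD mulrA ler_wpM2r ?exprn_ge0 ?(ltW t0)//.
    by rewrite exprMn mulrA ler_wpM2r ?exprn_ge0 ?(ltW t0)// dC.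
  rewrite ler_wpM2r ?exprn_ge0 ?(ltW t0)// ler_wpM2l ?(ltW C0)//.
  apply: le_trans (geom N0); rewrite lerDl mulr_ge0 ?exprn_ge0//; lra.
have : normc T0 <= normc (T0 + T1) + normc T1.
  rewrite -[X in normc X](addrK T1) -(normcN T1); exact: le_normcD.
rewrite nT0; have tm : 0 < t ^+ m by rewrite exprn_gt0.
rewrite -/D in hN; move: hN nT1.
set x := normc (T0 + T1); set y := normc T1; set p := t ^+ m in tm *.
have : C * (4 * t) * p <= D / 2 * p by rewrite ler_pM2r//; lra.
have : 0 < D * p by rewrite mulr_gt0.
by lra.
Qed.

Lemma has_taylorP (R : realType) (f : R[i] -> R[i]) (a : nat -> R[i]) :
  has_taylor f a <-> forall z, normc z < 1 ->
    ((fun n => normc (\sum_(0 <= k < n) a k * z ^+ k - f z)) @ \oo --> (0 : R))%classic.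
Proof.
split=> fa z z1.
  by apply: (cvg_normcP (series (fun k => a k * z ^+ k)) (f z)).1; apply/fa/unit_discE.
by apply: (cvg_normcP (series (fun k => a k * z ^+ k)) (f z)).2; apply/fa/unit_discE.
Qed.

Lemma has_taylor_unique (R : realType) (f : R[i] -> R[i]) (a b : nat -> R[i]) :
  has_taylor f a -> has_taylor f b -> a = b.
Proof.
move=> /has_taylorP fa /has_taylorP fb; apply/funext => n.
apply/eqP; rewrite -subr_eq0; apply/eqP; move: n.
apply: (@power_series_eq0 R (fun n => a n - b n)) => z z1.
have := cvgD (fa _ z1) (fb _ z1); rewrite addr0 => cv.
apply: (squeeze0_cvg _ (cv _)) => n; rewrite normc_ge0/=.
under eq_bigr => k _ do rewrite mulrBl.
rewrite sumrB; set A := \sum_(_ <= _ < _) _; set B := \sum_(_ <= _ < _) _.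
have -> : A - B = (A - f z) - (B - f z) by ring.
by rewrite (le_trans (le_normcD _ _))// normcN.
Qed.

Lemma taylorE (R : realType) (f : R[i] -> R[i]) (a : nat -> R[i]) :
  has_taylor f a -> taylor f = a.
Proof. by move=> fa; apply: xget_unique => // b fb; exact: has_taylor_unique fb fa. Qed.

Lemma analytic_taylor (R : realType) (f : R[i] -> R[i]) :
  analytic f -> has_taylor f (taylor f).
Proof. by move=> [a fa]; rewrite (taylorE fa). Qed.

(** [has_taylor] tests values inside the disc only, so both functions have the same expansions and
    [taylor] makes the same choice for them, analytic or not. *)
Lemma eq_weighted_normsq (R : realType) (w : nat -> R) (f g : R[i] -> R[i]) :
  (forall z, unit_disc z -> f z = g z) -> weighted_normsq w f = weighted_normsq w g.
Proof.
move=> fg; rewrite /weighted_normsq /taylor.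
suff -> : has_taylor f = has_taylor g by [].
apply/funext => a; apply/propext.
by split=> h z z1; have := h z z1; rewrite fg.
Qed.

(** * Coefficient sequences and summation by parts *)

(** Multiplication by [z] on coefficients, with the convention that the coefficient of index -1 is
    0. *)
Definition shift_coef (R : realType) (a : nat -> R[i]) (n : nat) : R[i] :=
  if n is k.+1 then a k else 0.

(** Coefficients of [g(z) / (1 - c * z)]: the Cauchy product of [g] with the powers of [c], written
    as the recursion that [(1 - c * z) * h = g] imposes. *)
Fixpoint geom_conv (R : realType) (c : R[i]) (g : nat -> R[i]) (n : nat) : R[i] :=
  if n is k.+1 then g n + c * geom_conv c g k else g 0%N.

Lemma geom_convE (R : realType) (c : R[i]) (g : nat -> R[i]) (n : nat) :
  geom_conv c g n = g n + c * shift_coef (geom_conv c g) n.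
Proof. by case: n => //=; rewrite mulr0 addr0. Qed.

(** Both sides expand to [|x|^2 + |y|^2] minus twice the real part of [a^* * x * y^*]. *)
Lemma normc_sqr_blaschke (R : rcfType) (a x y : R[i]) :
  normc (x - a * y) ^+ 2 + (1 - normc a ^+ 2) * normc y ^+ 2 =
  normc (y - a^* * x) ^+ 2 + (1 - normc a ^+ 2) * normc x ^+ 2.
Proof.
case: a x y => [a1 a2] [x1 x2] [y1 y2]; rewrite /normc /=.
by rewrite !sqr_sqrtr ?addr_ge0 ?sqr_ge0//; ring.
Qed.

(** Weight the preceding identity at [x = h_(k-1)], [y = h_k] by [w k] and sum by parts. The sum of
    increments has one term fewer, which leaves the boundary term [w n * |h n|^2] on the left. *)
Lemma abel_blaschke (R : realType) (w : nat -> R) (a : R[i]) (h : nat -> R[i]) (n : nat) :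
  \sum_(0 <= k < n.+1) w k * normc (shift_coef h k - a * h k) ^+ 2 +
    (1 - normc a ^+ 2) * (w n * normc (h n) ^+ 2) =
  \sum_(0 <= k < n.+1) w k * normc (h k - a^* * shift_coef h k) ^+ 2 +
    (1 - normc a ^+ 2) * \sum_(0 <= k < n) (w k.+1 - w k) * normc (h k) ^+ 2.
Proof.
elim: n => [|n IH].
  rewrite !big_nat1 big_geq//=.
  have := normc_sqr_blaschke a 0 (h 0%N) => e.
  transitivity (w 0%N * (normc (0 - a * h 0%N) ^+ 2 + (1 - normc a ^+ 2) * normc (h 0%N) ^+ 2)).
    by ring.
  by rewrite e normc0; ring.
rewrite [in LHS]big_nat_recr//= [in RHS]big_nat_recr//=.
rewrite [X in _ + _ * X = _]mulrC.
rewrite [X in _ = _ + _ * X]big_nat_recr//=.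
have := normc_sqr_blaschke a (h n) (h n.+1).
move: IH; set S1 := \sum_(_ <= _ < _) _; set S2 := \sum_(_ <= _ < _) _.
set S3 := \sum_(_ <= _ < _) _; set p := normc (_ - _) ^+ 2; set q := normc (_ - _) ^+ 2.
set u := normc (h n) ^+ 2; set v := normc (h n.+1) ^+ 2; set A := 1 - _ ^+ 2.
move=> IH e.
transitivity (S1 + A * (w n * u) + w n.+1 * (p + A * v) - A * (w n * u)); first by ring.
by rewrite IH e; ring.
Qed.

(** Young's inequality for convolution with the powers of [c], whose absolute sum is [(1 - |c|)^-1].
    The recursion gives it directly: the sum for [h] reappears on the right with factor [|c| < 1]
    and is absorbed. *)
Lemma geom_conv_sum_sqr (R : realType) (c : R[i]) (g : nat -> R[i]) (n : nat) :
  normc c < 1 ->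
  \sum_(0 <= k < n) normc (geom_conv c g k) ^+ 2 <=
    (1 - normc c)^-1 ^+ 2 * \sum_(0 <= k < n) normc (g k) ^+ 2.
Proof.
move=> c1; set h := geom_conv c g; set d := 1 - normc c.
have d0 : 0 < d by rewrite /d; lra.
(* Convexity of the square with weights [d] and [normc c], which add up to 1, at the points [x / d]
   and [y]. *)
have hn k : normc (h k) ^+ 2 <= d^-1 * normc (g k) ^+ 2 + normc c * normc (shift_coef h k) ^+ 2.
  have := le_normcD (g k) (c * shift_coef h k); rewrite -geom_convE normcM -/h.
  have := normc_ge0 (h k); have := normc_ge0 (g k); have := normc_ge0 (shift_coef h k).
  have := normc_ge0 c.
  set x := normc (g k); set y := normc (shift_coef h k).
  set z := normc (h k) => cp y0 x0 z0 zle.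
  apply: (@le_trans _ _ ((x + normc c * y) ^+ 2)).
    by rewrite lerXn2r ?nnegrE// addr_ge0// mulr_ge0.
  rewrite -subr_ge0.
  have -> : d^-1 * x ^+ 2 + normc c * y ^+ 2 - (x + normc c * y) ^+ 2 =
      normc c * d^-1 * (x - d * y) ^+ 2.
    by rewrite /d; field; rewrite lt0r_neq0.
  by rewrite mulr_ge0 ?sqr_ge0// mulr_ge0// invr_ge0 ltW.
have sh : \sum_(0 <= k < n) normc (shift_coef h k) ^+ 2 <= \sum_(0 <= k < n) normc (h k) ^+ 2.
  case: n => [|n]; first by rewrite !big_geq.
  rewrite big_nat_recl// [shift_coef h 0%N]/= normc0 expr0n/= add0r big_nat_recr//= lerDl.
  exact: sqr_ge0.
have : \sum_(0 <= k < n) normc (h k) ^+ 2 <=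
    d^-1 * \sum_(0 <= k < n) normc (g k) ^+ 2 + normc c * \sum_(0 <= k < n) normc (h k) ^+ 2.
  apply: (@le_trans _ _ (d^-1 * \sum_(0 <= k < n) normc (g k) ^+ 2 +
      normc c * \sum_(0 <= k < n) normc (shift_coef h k) ^+ 2)).
    rewrite !mulr_sumr -big_split /=; exact: ler_sum.
  by rewrite lerD2l ler_wpM2l// normc_ge0.
set S := \sum_(_ <= _ < _) _; set T := \sum_(_ <= _ < _) _ => ST.
rewrite expr2 -mulrA -ler_pdivrMl ?invr_gt0// invrK /d.
lra.
Qed.

(** * Expansions after division by [1 - c * z] and multiplication by [z - a] *)

(** Multiplying a partial sum for [h] by [1 - c * z] yields the one for [g] up to the boundary term
    [c * h_(n-1) * z ^+ n], which vanishes in the limit because [h] tends to 0. *)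
Lemma has_taylor_div (R : realType) (f : R[i] -> R[i]) (g : nat -> R[i]) (c : R[i]) :
  normc c < 1 -> ((fun n => normc (geom_conv c g n)) @ \oo --> (0 : R))%classic ->
  has_taylor f g -> has_taylor (fun z => f z / (1 - c * z)) (geom_conv c g).
Proof.
move=> c1 h0 /has_taylorP fg; apply/has_taylorP => z z1.
set h := geom_conv c g in h0 *.
have cz : 1 - c * z != 0.
  apply/eqP => /eqP; rewrite subr_eq0 => /eqP /(congr1 (@normc R)).
  rewrite normc1 normcM => e; have := normc_ge0 c; have := normc_ge0 z; nra.
have E n : \sum_(0 <= k < n) h k * z ^+ k - f z / (1 - c * z) =
   ((\sum_(0 <= k < n) g k * z ^+ k - f z) - c * (shift_coef h n * z ^+ n)) / (1 - c * z).
  suff -> : \sum_(0 <= k < n) g k * z ^+ k =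
      (1 - c * z) * \sum_(0 <= k < n) h k * z ^+ k + c * (shift_coef h n * z ^+ n).
    by field.
  elim: n => [|n IH]; first by rewrite !big_geq//=; ring.
  have gn : g n = h n - c * shift_coef h n by rewrite /h geom_convE addrK.
  by rewrite !big_nat_recr//= IH exprS gn; ring.
have sh0 : ((fun n => normc (shift_coef h n)) @ \oo --> (0 : R))%classic.
  by rewrite -(cvg_shiftS (fun n => normc (shift_coef h n))).
have := @cvgMl_tmp _ _ _ _ _ (normc (1 - c * z)^-1) _ (cvgD (fg z z1) sh0).
rewrite addr0 mulr0 => cv.
apply: (squeeze0_cvg _ (cv _ _)) => n; rewrite normc_ge0 /= E mulrC normcM ler_wpM2l ?normc_ge0//.
apply: le_trans (le_normcD _ _) _; rewrite lerD2l normcN !normcM normcX.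
have hc := normc_ge0 c; have hz := normc_ge0 z; have hs := normc_ge0 (shift_coef h n).
have zn0 : 0 <= normc z ^+ n by exact: exprn_ge0.
have zn1 : normc z ^+ n <= 1 by rewrite exprn_ile1// ltW.
apply: (@le_trans _ _ (1 * (normc (shift_coef h n) * 1))); last by rewrite mul1r mulr1.
by rewrite ler_pM ?mulr_ge0// ?(ltW c1)// ler_pM.
Qed.

Lemma has_taylor_mul_linear (R : realType) (f : R[i] -> R[i]) (h : nat -> R[i]) (a : R[i]) :
  ((fun n => normc (h n)) @ \oo --> (0 : R))%classic ->
  has_taylor f h -> has_taylor (fun z => (z - a) * f z) (fun n => shift_coef h n - a * h n).
Proof.
move=> h0 /has_taylorP fh; apply/has_taylorP => z z1.
have E n : \sum_(0 <= k < n) (shift_coef h k - a * h k) * z ^+ k - (z - a) * f z =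
   (z - a) * (\sum_(0 <= k < n) h k * z ^+ k - f z) - shift_coef h n * z ^+ n.
  suff -> : \sum_(0 <= k < n) (shift_coef h k - a * h k) * z ^+ k =
      (z - a) * \sum_(0 <= k < n) h k * z ^+ k - shift_coef h n * z ^+ n by ring.
  elim: n => [|n IH]; first by rewrite !big_geq//=; ring.
  by rewrite !big_nat_recr//= IH exprS; ring.
have sh0 : ((fun n => normc (shift_coef h n)) @ \oo --> (0 : R))%classic.
  by rewrite -(cvg_shiftS (fun n => normc (shift_coef h n))).
have := cvgD (@cvgMl_tmp _ _ _ _ _ (normc (z - a)) _ (fh z z1)) sh0.
rewrite mulr0 addr0 => cv.
apply: (squeeze0_cvg _ (cv _ _)) => n; rewrite normc_ge0 /= E.
apply: le_trans (le_normcD _ _) _; rewrite normcN !normcM normcX lerD2l.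
by rewrite ler_piMr ?normc_ge0// exprn_ile1 ?normc_ge0// ltW.
Qed.

(** * Nonnegative series and membership in the Hardy space *)

Lemma nneseries_EFin_le (R : realType) (u : nat -> R) (r : \bar R) :
  (forall n, 0 <= u n) -> (forall n, (\sum_(0 <= k < n) u k)%:E <= r)%E ->
  (\sum_(0 <= k <oo) (u k)%:E <= r)%E.
Proof.
move=> u0 ur; apply: lime_le.
  by apply: is_cvg_nneseries => k _ _; rewrite lee_fin.
by apply: nearW => n; rewrite sumEFin.
Qed.

Lemma nneseries_EFin_ge (R : realType) (u : nat -> R) (n : nat) :
  (forall n, 0 <= u n) ->
  ((\sum_(0 <= k < n) u k)%:E <= \sum_(0 <= k <oo) (u k)%:E)%E.
Proof.
by move=> u0; rewrite -sumEFin; apply: nneseries_lim_ge => k _ _; rewrite lee_fin.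
Qed.

Lemma cvg_normc0_sum_sqr (R : realType) (h : nat -> R[i]) (r : R) :
  (forall n, \sum_(0 <= k < n) normc (h k) ^+ 2 <= r) ->
  ((fun n => normc (h n)) @ \oo --> (0 : R))%classic.
Proof.
move=> hr.
have /cvg_series_cvg_0/cvgrPdist_lt cv : cvgn (series (fun n => normc (h n) ^+ 2)).
  apply: nondecreasing_is_cvgn; last by exists r => _ [n _ <-]; exact: hr.
  by apply/nondecreasing_seqP => n; rewrite /series /= big_nat_recr//= lerDl sqr_ge0.
apply/cvgrPdist_lt => e e0.
have := cv (e ^+ 2); rewrite exprn_gt0// => /(_ isT).
apply: filterS => n; rewrite !sub0r !normrN ger0_norm ?sqr_ge0// ger0_norm ?normc_ge0//.
by rewrite ltr_pXn2r ?nnegrE ?normc_ge0 ?(ltW e0).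
Qed.

(** Trades the extended-real norm for a uniform bound on real partial sums of any one expansion. *)
Lemma in_H2P (R : realType) (f : R[i] -> R[i]) :
  in_H2 f <-> exists a, has_taylor f a /\
    exists r : R, forall n, \sum_(0 <= k < n) normc (a k) ^+ 2 <= r.
Proof.
have u0 (a : nat -> R[i]) n : 0 <= 1 * normc (a n) ^+ 2 by rewrite mul1r sqr_ge0.
split=> [[fa]|[a [fa [r ar]]]].
  rewrite /H2_normsq /weighted_normsq => f2.
  exists (taylor f); split; first exact: analytic_taylor.
  exists (fine (\sum_(0 <= n <oo) (1 * normc (taylor f n) ^+ 2)%:E)) => n.
  rewrite -lee_fin fineK.
    apply: le_trans (nneseries_EFin_ge n (u0 _)).
    by rewrite lee_fin; under [leRHS]eq_bigr do rewrite mul1r.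
  by rewrite ge0_fin_numE//; apply: nneseries_ge0 => k _ _; rewrite lee_fin.
split; first by exists a.
rewrite /H2_normsq /weighted_normsq (taylorE fa).
apply: (@le_lt_trans _ _ r%:E); last exact: ltry.
apply: nneseries_EFin_le (u0 _) _ => n.
by rewrite lee_fin; under eq_bigr do rewrite mul1r.
Qed.

(** * The gain from one Blaschke factor *)

(** The limit of [abel_blaschke]. Since [w] may be unbounded, [h] tending to 0 does not by itself
    control the boundary term, so each partial sum of the left side is bounded separately. *)
Lemma blaschke_weighted_le (R : realType) (w : nat -> R) (a : R[i]) (h : nat -> R[i]) :
  (forall n, 0 <= w n) -> {homo w : m n / (m <= n)%N >-> m <= n} -> normc a <= 1 ->
  ((fun n => normc (h n)) @ \oo --> (0 : R))%classic ->
  (\sum_(0 <= n <oo) (w n * normc (h n - a^* * shift_coef h n) ^+ 2)%:E +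
   (1 - normc a ^+ 2)%:E * \sum_(0 <= n <oo) ((w n.+1 - w n) * normc (h n) ^+ 2)%:E <=
   \sum_(0 <= n <oo) (w n * normc (shift_coef h n - a * h n) ^+ 2)%:E)%E.
Proof.
move=> w0 wm a1 h0.
have A0 : 0 <= 1 - normc a ^+ 2 by rewrite subr_ge0 exprn_ile1// normc_ge0.
have dw n : 0 <= w n.+1 - w n by rewrite subr_ge0 wm.
set f := fun n => shift_coef h n - a * h n; set g := fun n => h n - a^* * shift_coef h n.
rewrite -nneseriesZl; last by move=> n _; rewrite lee_fin mulr_ge0// sqr_ge0.
rewrite -nneseriesD; last 2 first.
- by move=> n _ _; rewrite lee_fin mulr_ge0// sqr_ge0.
- by move=> n _ _; rewrite -EFinM lee_fin; exact: mulr_ge0 A0 (mulr_ge0 (dw n) (sqr_ge0 _)).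
have fn0 n : 0 <= w n * normc (f n) ^+ 2 by rewrite mulr_ge0// sqr_ge0.
under eq_eseriesr => n _ do rewrite -EFinM -EFinD.
apply: nneseries_EFin_le.
  move=> n; apply: addr_ge0; first exact: mulr_ge0 (w0 n) (sqr_ge0 _).
  exact: mulr_ge0 A0 (mulr_ge0 (dw n) (sqr_ge0 _)).
move=> M.
case: (ltP (\sum_(0 <= n <oo) (w n * normc (f n) ^+ 2)%:E)%E +oo%E); last first.
  by rewrite leye_eq => /eqP ->; rewrite leey.
set W := (\sum_(0 <= n <oo) _)%E => Woo.
have Wfin : W \is a fin_num.
  by rewrite ge0_fin_numE//; apply: nneseries_ge0 => k _ _; rewrite lee_fin.
rewrite -(fineK Wfin) lee_fin.
have Wle n : \sum_(0 <= k < n) w k * normc (f k) ^+ 2 <= fine W.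
  by rewrite -lee_fin fineK//; exact: nneseries_EFin_ge.
(* Freezing the weights beyond [M] keeps them bounded, so that the boundary term of the
   summation by parts tends to 0. *)
pose v n := w (minn n M).
apply/ler_addgt0Pr => e e0.
have /cvgrPdist_lt : ((fun n => normc (h n) * normc (h n)) @ \oo --> (0 : R))%classic.
  by have := cvgM h0 h0; rewrite mulr0; apply.
(* The [+ 1] keeps the denominator positive when [w M = 0]. The index [N0 + M] lies past both the
   tolerance threshold and the freezing point. *)
move=> /(_ (e / (w M + 1))); have wM1 : 0 < w M + 1 by rewrite ltr_wpDl.
move=> /(_ (divr_gt0 e0 wM1)) [N0 _ /(_ (N0 + M)%N)] /(_ (leq_addr _ _)) /=.
rewrite sub0r normrN ger0_norm; last by rewrite mulr_ge0 ?normc_ge0.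
set N := (N0 + M)%N; rewrite -expr2 => hN.
have vm : {homo v : m n / (m <= n)%N >-> m <= n} by move=> m n mn; apply: wm; lia.
have vw k : v k <= w k by apply: wm; lia.
have v0 k : 0 <= v k by exact: w0.
have vE k : (k <= M)%N -> v k = w k by move=> kM; rewrite /v; congr w; lia.
have head (b d : nat -> R) n : (M <= n)%N -> (forall k, 0 <= d k) ->
    (forall k, (k < M)%N -> b k = d k) -> \sum_(0 <= k < M) b k <= \sum_(0 <= k < n) d k.
  move=> Mn d0 bd; rewrite [leRHS](big_cat_nat (n := M))//= -[leLHS]addr0 lerD//.
    by rewrite big_nat_cond [leRHS]big_nat_cond ler_sum// => k /andP[/andP[_ /bd->]].
  by rewrite sumr_ge0.
have vG : \sum_(0 <= k < M) w k * normc (g k) ^+ 2 <=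
    \sum_(0 <= k < N.+1) v k * normc (g k) ^+ 2.
  apply: head => [|k|k kM]; [by rewrite /N; lia| |by rewrite vE// ltnW].
  by rewrite mulr_ge0// sqr_ge0.
have vH : \sum_(0 <= k < M) (w k.+1 - w k) * normc (h k) ^+ 2 <=
    \sum_(0 <= k < N) (v k.+1 - v k) * normc (h k) ^+ 2.
  apply: head => [|k|k kM]; [by rewrite /N; lia| |by rewrite !vE// ltnW].
  by rewrite mulr_ge0 ?sqr_ge0// subr_ge0 vm.
have vF : \sum_(0 <= k < N.+1) v k * normc (f k) ^+ 2 <= fine W.
  by apply: le_trans (Wle N.+1); apply: ler_sum => k _; rewrite ler_wpM2r ?sqr_ge0.
have bd : (1 - normc a ^+ 2) * (v N * normc (h N) ^+ 2) <= e.
  have -> : v N = w M by rewrite /v; congr w; rewrite /N; lia.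
  have hN0 : 0 <= normc (h N) ^+ 2 by exact: sqr_ge0.
  apply: (@le_trans _ _ ((w M + 1) * normc (h N) ^+ 2)); last first.
    by rewrite mulrC -ler_pdivlMr// ltW.
  rewrite -[leRHS]mul1r; apply: ler_pM => //; first exact: mulr_ge0.
    by rewrite gerBl sqr_ge0.
  by rewrite ler_wpM2r// lerDl.
rewrite big_split /= -mulr_sumr.
have := abel_blaschke v a h N; rewrite -/f -/g.
have := ler_wpM2l A0 vH.
move: vG vF bd; rewrite /f /g.
set x1 := \sum_(_ <= _ < _) _; set x2 := \sum_(_ <= _ < _) _ => ? ?.
lra.
Qed.

Lemma normc_conj (R : rcfType) (a : R[i]) : normc a^* = normc a.
Proof. by case: a => x y; rewrite /normc /= sqrrN. Qed.

Lemma weighted_normsq_ge0 (R : realType) (w : nat -> R) (f : R[i] -> R[i]) :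
  (forall n, 0 <= w n) -> (0 <= weighted_normsq w f)%E.
Proof.
by move=> w0; apply: nneseries_ge0 => n _ _; rewrite lee_fin mulr_ge0 ?sqr_ge0.
Qed.

(** Everything is read off the coefficients [h] of [G / (1 - a^* * z)]. The two memberships allow
    the estimate to be iterated. *)
Lemma blaschke_factor_le (R : realType) (a : R[i]) (G : R[i] -> R[i]) :
  normc a < 1 -> in_H2 G ->
  [/\ in_H2 (fun z => G z / (1 - a^* * z)),
      in_H2 (fun z => (z - a) / (1 - a^* * z) * G z) &
      forall w : nat -> R, (forall n, 0 <= w n) ->
        {homo w : m n / (m <= n)%N >-> m <= n} ->
        (weighted_normsq w G + (1 - normc a ^+ 2)%:E *
           weighted_normsq (fun n => w n.+1 - w n)%R (fun z => G z / (1 - a^* * z))%R <=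
         weighted_normsq w (fun z => (z - a) / (1 - a^* * z) * G z)%R)%E].
Proof.
move=> a1 /in_H2P[g [Gg [r gr]]].
have ca1 : normc a^* < 1 by rewrite normc_conj.
pose h := geom_conv a^* g.
have hr n : \sum_(0 <= k < n) normc (h k) ^+ 2 <= (1 - normc a^*)^-1 ^+ 2 * r.
  by apply: le_trans (geom_conv_sum_sqr g n ca1) _; rewrite ler_wpM2l ?sqr_ge0.
have h0 := cvg_normc0_sum_sqr hr.
have Hh : has_taylor (fun z => G z / (1 - a^* * z)) h by exact: has_taylor_div.
have Ff : has_taylor (fun z => (z - a) / (1 - a^* * z) * G z) (fun n => shift_coef h n - a * h n).
  rewrite (_ : (fun z => _) = fun z => (z - a) * (G z / (1 - a^* * z))).
    exact: has_taylor_mul_linear.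
  by apply/funext => z; rewrite mulrAC mulrA.
have gE : g = fun n => h n - a^* * shift_coef h n.
  by apply/funext => n; rewrite /h geom_convE addrK.
clearbody h.
split.
- by apply/in_H2P; exists h; split=> //; eexists; exact: hr.
- apply/in_H2P; exists (fun n => shift_coef h n - a * h n); split=> //; exists r => n.
  apply: (@le_trans _ _ (\sum_(0 <= k < n.+1) normc (shift_coef h k - a * h k) ^+ 2)).
    by rewrite [leRHS]big_nat_recr//= lerDl sqr_ge0.
  apply: le_trans (gr n.+1).
  (* The constant weight has zero increments, so partial sums for the product are at most those for
     [G]. *)
  have := abel_blaschke (fun=> 1) a h n.
  rewrite [X in _ = _ + _ * X]big1 => [|k _]; last by rewrite subrr mul0r.
  under eq_bigr do rewrite mul1r.
  under [X in _ = X + _]eq_bigr do rewrite mul1r.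
  rewrite mulr0 addr0 gE => <-.
  by rewrite lerDl mul1r mulr_ge0 ?sqr_ge0// subr_ge0 exprn_ile1 ?normc_ge0// ltW.
move=> w w0 wm; rewrite /weighted_normsq (taylorE Gg) (taylorE Hh) (taylorE Ff) gE.
exact: blaschke_weighted_le (ltW a1) h0.
Qed.

(** * Products of Blaschke factors *)

(** Membership is carried through the induction because the next factor acts on the partial product.
    The weight stays general so that increments of a weight can be used as well. *)
Lemma blaschke_prod_monotone (R : realType) (I : Type) (s : seq I) (alpha : I -> R[i])
    (G : R[i] -> R[i]) :
  (forall j, normc (alpha j) < 1) -> in_H2 G ->
  in_H2 (fun z => \prod_(j <- s) ((z - alpha j) / (1 - (alpha j)^* * z)) * G z) /\
  forall w : nat -> R, (forall n, 0 <= w n) ->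
    {homo w : m n / (m <= n)%N >-> m <= n} ->
    (weighted_normsq w G <= weighted_normsq w
      (fun z => \prod_(j <- s) ((z - alpha j) / (1 - (alpha j)^* * z)) * G z)%R)%E.
Proof.
move=> a1 GH; elim: s => [|j s [IH1 IH2]].
  by under eq_fun do rewrite big_nil mul1r.
under eq_fun do rewrite big_cons -mulrA.
have [_ F1 F2] := blaschke_factor_le (a1 j) IH1.
split; first exact: F1.
move=> w w0 wm; apply: (le_trans (IH2 w w0 wm)).
apply: le_trans (F2 w w0 wm).
rewrite leeDl//; apply: mule_ge0.
  by rewrite lee_fin subr_ge0 exprn_ile1 ?normc_ge0// ltW.
by apply: weighted_normsq_ge0 => n; rewrite subr_ge0 wm.
Qed.

Lemma blaschke_prod_le (R : realType) (I : Type) (s : seq I) (alpha : I -> R[i])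
    (G : R[i] -> R[i]) (w : nat -> R) :
  (forall j, normc (alpha j) < 1) -> in_H2 G -> (forall n, 0 <= w n) ->
  {homo w : m n / (m <= n)%N >-> m <= n} ->
  {homo (fun n => w n.+1 - w n) : m n / (m <= n)%N >-> m <= n} ->
  (weighted_normsq w G + \sum_(j <- s) (1 - normc (alpha j) ^+ 2)%:E *
     weighted_normsq (fun n => w n.+1 - w n)%R (fun z => G z / (1 - (alpha j)^* * z))%R <=
   weighted_normsq w
     (fun z => \prod_(j <- s) ((z - alpha j) / (1 - (alpha j)^* * z)) * G z)%R)%E.
Proof.
move=> a1 GH w0 wm dwm; elim: s => [|j s IH].
  by rewrite big_nil adde0; under [in leRHS]eq_fun do rewrite big_nil mul1r.
rewrite big_cons; under [in leRHS]eq_fun do rewrite big_cons -mulrA.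
have [FH _] := blaschke_prod_monotone s a1 GH.
have [_ _ /(_ w w0 wm) step] := blaschke_factor_le (a1 j) FH.
have [GjH _ _] := blaschke_factor_le (a1 j) GH.
(* The gain of factor [j] involves the product of the remaining factors times
   [G / (1 - (alpha j)^* * z)]. As the increments are nondecreasing, dropping those factors can only
   lower it. *)
have [_ /(_ _ _ dwm) mono] := blaschke_prod_monotone s a1 GjH.
apply: le_trans step.
have aux (x y c x' c' : \bar R) :
    (x + y <= x' -> c <= c' -> x + (c + y) <= x' + c')%E.
  by move=> le1 le2; rewrite addeCA addeC leeD.
apply: aux; first exact: IH.
apply: lee_wpmul2l.
  by rewrite lee_fin subr_ge0 exprn_ile1 ?normc_ge0// ltW.
apply: le_trans (mono _) _; first by move=> n; rewrite subr_ge0 wm.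
rewrite le_eqVlt; apply/orP; left; apply/eqP.
by apply: eq_weighted_normsq => z _; exact: mulrA.
Qed.

(** * The weight [n^2 + 1] and the conclusion *)

(** Coefficientwise this is [2 * (n + 1) - 1 = 2 * n + 1]. Finiteness of the Hardy norm lets it be
    cancelled even if the Dirichlet norm is infinite. *)
Lemma dirichlet_sub_H2 (R : realType) (f : R[i] -> R[i]) : in_H2 f ->
  (2%:E * Dirichlet_normsq f - H2_normsq f =
   weighted_normsq (fun n => (n.+1%:R ^+ 2 + 1) - (n%:R ^+ 2 + 1) : R)%R f)%E.
Proof.
move=> [_ f2].
have fin : H2_normsq f \is a fin_num by rewrite ge0_fin_numE// weighted_normsq_ge0.
rewrite -[RHS](addeK _ fin); congr (_ - _)%E.
rewrite /Dirichlet_normsq /H2_normsq /weighted_normsq.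
rewrite -nneseriesZl; last by move=> n _; rewrite lee_fin mulr_ge0 ?sqr_ge0.
rewrite -nneseriesD; last 2 first.
- move=> n _ _; rewrite lee_fin mulr_ge0 ?sqr_ge0//.
  by rewrite -natr1 sqrrD1; have := ler0n R n; lra.
- by move=> n _ _; rewrite lee_fin mul1r sqr_ge0.
apply: eq_eseriesr => n _; rewrite -EFinM -EFinD -natr1; congr (_%:E); ring.
Qed.

Theorem corollary4 (R : realType) (F G : R[i] -> R[i]) (m : nat)
    (alpha : 'I_m -> R[i]) :
  in_W12 F ->
  disc_zeros F alpha ->
  blaschke_decomposition F alpha G ->
  (W12_normsq G <=
   W12_normsq F -
   \sum_(j < m) (1 - Normc.normc (alpha j) ^+ 2)%:E *
     (2%:E * Dirichlet_normsq (fun z => (G z / (1 - (alpha j)^* * z))%R)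
      - H2_normsq (fun z => (G z / (1 - (alpha j)^* * z))%R)))%E.
Proof.
move=> [_ Foo] [alpha1 _] [GH _ FG].
have a1 j : normc (alpha j) < 1 by apply/unit_discE; exact: alpha1.
pose w n : R := n%:R ^+ 2 + 1.
have w0 n : 0 <= w n by rewrite addr_ge0 ?sqr_ge0.
have wm : {homo w : m n / (m <= n)%N >-> m <= n}.
  by move=> p q pq; rewrite lerD2r lerXn2r ?nnegrE ?ler_nat.
have dwm : {homo (fun n => w n.+1 - w n) : m n / (m <= n)%N >-> m <= n}.
  move=> p q pq; have : p%:R <= q%:R :> R by rewrite ler_nat.
  by rewrite /w -!natr1 !sqrrD1; lra.
have := blaschke_prod_le (index_enum 'I_m) a1 GH w0 wm dwm.
rewrite -(eq_weighted_normsq w FG) => le_F.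
have HH j : in_H2 (fun z => G z / (1 - (alpha j)^* * z)).
  by have [] := blaschke_factor_le (a1 j) GH.
under eq_bigr => j _ do rewrite (dirichlet_sub_H2 (HH j)).
set S := (\sum_(j < m) _)%E in le_F *.
have S0 : (0 <= S)%E.
  apply: sume_ge0 => j _; apply: mule_ge0.
    by rewrite lee_fin subr_ge0 exprn_ile1 ?normc_ge0// ltW.
  by apply: weighted_normsq_ge0 => n; rewrite subr_ge0 wm.
(* Moving [S] across the inequality requires it to be finite; by [le_F] it is at most the finite
   norm of [F]. *)
rewrite leeBrDr//.
rewrite ge0_fin_numE//; apply: le_lt_trans Foo; apply: le_trans le_F.
by rewrite leeDr// weighted_normsq_ge0.
Qed.
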